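(* For every $n\ge 0$, the map $\phi$ is a bijection from the set of Motzkin paths of length $2n+1$ to the set of paths in $\mathcal{A}^{Q}$ of horizontal length $n$, and also from the set of Grand Motzkin paths of length $2n+1$ to the set of paths in $\mathcal{A}^{H}$ of horizontal length $n$; its inverse is $\psi$.
   Context: A lattice path is a finite sequence of steps (vectors in $\mathbb{Z}^2$) starting at $(0,0)$; its vertices are the partial sums. Let $S_{M}=\{(1,0),(1,1),(1,-1)\}$ and $S_{MW}=S_M\cup\{(0,1),(0,-1)\}$; $(0,\pm1)$ are vertical steps. A Grand Motzkin path of length $L$ is a lattice path of $L$ steps from $S_M$ (any endpoint); a Motzkin path of length $L$ is a Grand Motzkin path of length $L$ all of whose vertices have $y\ge0$. A vertically constrained $S_{MW}$ path is a lattice path with steps in $S_{MW}$ with no two consecutive vertical steps; its horizontal length is the $x$-coordinate of its endpoint. $\mathcal{A}^{H}$ is the set of all vertically constrained $S_{MW}$ paths, and $\mathcal{A}^{Q}$ the subset of those all of whose vertices have $y\ge 0$. The map $\phi$ acts on a path with steps $e_1,\dots,e_{2n+1}$ by modifying each step $e_i$ with $i$ odd: $(1,1)\mapsto(0,1)$, $(1,-1)\mapsto(0,-1)$, and $(1,0)$ is deleted; steps with even index are kept. The map $\psi$ acts on a vertically constrained $S_{MW}$ path of horizontal length $n$ as follows: for each $i\in\{0,1,\dots,n\}$ (there is at most one vertical step at $x$-coordinate $i$), if there is a vertical step at $x=i$, replace $(0,1)$ by $(1,1)$ and $(0,-1)$ by $(1,-1)$; otherwise insert a step $(1,0)$ at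 the vertex with $x$-coordinate $i$ (subsequent steps being shifted accordingly). *)

(* Defs.v *)
From mathcomp Require Export all_boot all_order all_algebra.
From mathcomp Require Export boolp classical_sets functions.

Set Implicit Arguments.
Unset Strict Implicit.
Unset Printing Implicit Defensive.

Import Order.TTheory GRing.Theory Num.Theory.

Local Open Scope classical_set_scope.
Local Open Scope ring_scope.

Definition step : Type := (int * int)%type.

Definition lattice_path : Type := seq step.

Definition S_M : seq step := [:: (1, 0); (1, 1); (1, -1)].

Definition S_MW : seq step := S_M ++ [:: (0, 1); (0, -1)].

Definition vertical (e : step) : bool := e \in [:: (0, 1); (0, -1)].

Definition vertex (p : lattice_path) (k : nat) : int * int := \sum_(e <- take k p) e.

Definition vertices (p : lattice_path) : seq (int * int) :=
  [seq vertex p k | k <- iota 0 (size p).+1].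

Definition nonneg_path (p : lattice_path) : Prop :=
  forall v, v \in vertices p -> 0 <= v.2.

Definition hlength (p : lattice_path) : int := (vertex p (size p)).1.

Definition grand_motzkin (L : nat) : set lattice_path :=
  [set p | size p = L /\ {subset p <= S_M}].

Definition motzkin (L : nat) : set lattice_path :=
  [set p | grand_motzkin L p /\ nonneg_path p].

Definition A_H : set lattice_path :=
  [set p | {subset p <= S_MW} /\
    forall k : nat, (k.+1 < size p)%N ->
      ~ (vertical (nth 0 p k) /\ vertical (nth 0 p k.+1))].

Definition A_Q : set lattice_path := [set p | A_H p /\ nonneg_path p].

(* The value is a sequence so that the step (1,0) can be deleted; the last
   branch is never reached on steps of S_M. *)
Definition phi_step (e : step) : seq step :=
  if e == (1, 1) then [:: (0, 1)]
  else if e == (1, -1) then [:: (0, -1)]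
  else if e == (1, 0) then [::]
  else [:: e].

(* The 1-based step e_i is nth 0 p i.-1. *)
Definition phi (p : lattice_path) : lattice_path :=
  flatten [seq (let e := nth 0 p i.-1 in
                if odd i then phi_step e else [:: e])
          | i <- iota 1 (size p)].

Definition psi_step (e : step) : step :=
  if e == (0, 1) then (1, 1)
  else if e == (0, -1) then (1, -1)
  else e.

Definition steps_from (p : lattice_path) (i : nat) : seq step :=
  [seq nth 0 p k | k <- iota 0 (size p) & (vertex p k).1 == i%:Z].

(* When no vertical step lies on the line x = i, the path has a single vertex
   there, and inserting (1,0) at it means inserting it in front of the steps
   that leave from it. *)
Definition psi_block (p : lattice_path) (i : nat) : seq step :=
  if has vertical (steps_from p i) then map psi_step (steps_from p i)
  else (1, 0) :: steps_from p i.

(* absz (hlength p) is the horizontal length as a nat; it is nonnegative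
   whenever the steps are in S_MW. *)
Definition psi (p : lattice_path) : lattice_path :=
  flatten [seq psi_block p i | i <- iota 0 (absz (hlength p)).+1].

Definition bijection_with_inverse (T U : Type) (A : set T) (B : set U)
    (f : T -> U) (g : U -> T) : Prop :=
  [/\ set_bij A B f, set_fun B A g,
      {in A, cancel f g} & {in B, cancel g f}].

(* Main.v *)
Require Import Defs.

Set Implicit Arguments.
Unset Strict Implicit.
Unset Printing Implicit Defensive.

Import Order.TTheory GRing.Theory Num.Theory.

Local Open Scope classical_set_scope.
Local Open Scope ring_scope.

(** Both kinds of path are encoded by the same data: a sequence of pairs
    [(a_1, b_1), ..., (a_n, b_n)] of Motzkin steps and a last Motzkin step [d].
    Read in order, these are the steps of a Grand Motzkin path of length
    [2n + 1]; replacing each [a_i] and [d] by its image under [phi_step] gives a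
    vertically constrained path of horizontal length [n], in which [b_i] is the
    step from [x = i - 1] to [x = i] and [a_i] the optional vertical step before
    it. The heights visited by the two paths are the same, because the only
    steps deleted are level. *)

Implicit Types (p : lattice_path) (a b d e : step) (bs : seq (step * step)).

Lemma bijection_with_inverse_cancel (T U : Type) (A : set T) (B : set U)
    (f : T -> U) (g : U -> T) :
  set_fun A B f -> set_fun B A g ->
  (forall x, A x -> g (f x) = x) -> (forall y, B y -> f (g y) = y) ->
  bijection_with_inverse A B f g.
Proof.
move=> fAB gBA fK gK; split => //; last 2 first.
- by move=> x; rewrite inE => /fK.
- by move=> y; rewrite inE => /gK.
split=> //.
- by move=> x y; rewrite !inE => Ax Ay fxy; rewrite -(fK x Ax) fxy fK.
- by move=> y By; exists (g y); [exact: gBA | exact: gK].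
Qed.

(** * Vertices, horizontal length and heights by recursion on the path *)

Lemma vertex0 p : vertex p 0 = 0.
Proof. by rewrite /vertex take0 big_nil. Qed.

Lemma vertexS e p k : vertex (e :: p) k.+1 = e + vertex p k.
Proof. by rewrite /vertex /= big_cons. Qed.

Lemma hlength_cons e p : hlength (e :: p) = e.1 + hlength p.
Proof. by rewrite /hlength /= vertexS. Qed.

Lemma hlength_nil : hlength [::] = 0.
Proof. by rewrite /hlength vertex0. Qed.

(** The starting height is a parameter because removing the first step leaves a path that starts at
    another height. *)
Fixpoint nonneg_from (y : int) p : bool :=
  (0 <= y) && (if p is e :: p' then nonneg_from (y + e.2) p' else true).

Lemma nonneg_fromP (y : int) p :
  reflect (forall k, (k <= size p)%N -> 0 <= y + (vertex p k).2)
          (nonneg_from y p).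
Proof.
elim: p y => [|e p IH] y /=.
  rewrite andbT; apply: (iffP idP) => [y0 [|//] _|/(_ 0%N isT)];
  by rewrite vertex0 addr0.
apply: (iffP andP) => [[y0 /IH yp] [|k] kp|yp].
- by rewrite vertex0 addr0.
- by rewrite vertexS addrA; apply: yp.
split; first by have := yp 0%N isT; rewrite vertex0 addr0.
by apply/IH => k kp; have := yp k.+1 kp; rewrite vertexS addrA.
Qed.

Lemma nonneg_pathE p : nonneg_path p <-> nonneg_from 0 p.
Proof.
split => [pn|/nonneg_fromP pn v].
  apply/nonneg_fromP => k kp; rewrite add0r; apply: pn.
  by apply: map_f; rewrite mem_iota add0n ltnS.
move=> /mapP[k]; rewrite mem_iota add0n ltnS => /= kp ->.
by have := pn k kp; rewrite add0r.
Qed.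

Lemma phi1 d : phi [:: d] = phi_step d.
Proof. by rewrite /phi /= cats0. Qed.

(** Removing two steps keeps the parity of every later index, so [phi] treats the tail as a path of
    its own. *)
Lemma phi_cons2 a b p : phi [:: a, b & p] = phi_step a ++ b :: phi p.
Proof.
rewrite /phi /=; congr (_ ++ _ :: flatten _).
rewrite (iotaDl 2 1) -map_comp; apply/eq_in_map => i.
rewrite mem_iota => /andP[i0 _] /=.
by rewrite negbK; case: i i0.
Qed.

Definition nonvert2 : rel step := fun a b => ~~ (vertical a && vertical b).

Lemma A_HP p : A_H p <-> all [in S_MW] p /\ sorted nonvert2 p.
Proof.
split => -[pS pv]; split.
- exact/allP.
- apply/(sortedP 0) => k kp; apply/negP => /andP[v1 v2].
  by apply: (pv k kp).
- exact/allP.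
- move=> k kp [v1 v2].
  by have /(_ k kp) := sortedP 0 pv; rewrite /nonvert2 v1 v2.
Qed.

Lemma path_nonvert2 e p : ~~ vertical e -> path nonvert2 e p = sorted nonvert2 p.
Proof. by case: p => //= f p /negbTE ve; rewrite /nonvert2 ve. Qed.

Lemma S_M_cases (P : step -> Prop) :
  P (1, 0) -> P (1, 1) -> P (1, -1) -> forall e, e \in S_M -> P e.
Proof. by move=> P0 P1 P2 e; rewrite !inE => /or3P[] /eqP ->. Qed.

(** * The common encoding of both kinds of path *)

Definition motzkin_of bs d : lattice_path :=
  foldr (fun ab p => [:: ab.1, ab.2 & p]) [:: d] bs.

Definition constrained_of bs d : lattice_path :=
  foldr (fun ab p => phi_step ab.1 ++ ab.2 :: p) (phi_step d) bs.

Definition code bs d : bool :=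
  all (fun ab => (ab.1 \in S_M) && (ab.2 \in S_M)) bs && (d \in S_M).

Lemma code_cons a b bs d :
  code ((a, b) :: bs) d = [&& a \in S_M, b \in S_M & code bs d].
Proof. by rewrite /code /= !andbA. Qed.

Lemma grand_motzkinP n p :
  grand_motzkin (2 * n + 1) p <->
  exists bs d, [/\ code bs d, size bs = n & p = motzkin_of bs d].
Proof.
split => [[]|[bs [d [cbs <- ->]]]]; last first.
  suff: size (motzkin_of bs d) = (2 * size bs + 1)%N /\
        all [in S_M] (motzkin_of bs d) by case=> sz /allP.
  elim: bs cbs => [|[a b] bs IH]; first by rewrite /= andbT.
  rewrite code_cons => /and3P[aS bS /IH[/= -> ->]]; rewrite aS bS.
  by split=> //; rewrite mulnS.
elim: n p => [|n IH] p.
  case: p => [|d [|]] //= _ dS; exists [::], d; split=> //.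
  by apply: dS; rewrite inE.
rewrite mulnS; case: p => [|a [|b p]] //= [sp] pS.
have [|bs [d [cbs <- ->]]] := IH p sp.
  by move=> e ep; apply: pS; rewrite !inE ep !orbT.
exists ((a, b) :: bs), d; split=> //.
by rewrite code_cons cbs !pS // !inE eqxx ?orbT.
Qed.

Lemma hlength_constrained_of bs d : code bs d ->
  hlength (constrained_of bs d) = (size bs)%:Z.
Proof.
elim: bs => [|[a b] bs IH].
  by move: d; rewrite /code /=; apply: S_M_cases;
    rewrite /= ?hlength_cons hlength_nil.
rewrite code_cons => /and3P[aS bS /IH /= {}IH].
have b1 : b.1 = 1 by move: b bS; apply: S_M_cases.
move: a aS; apply: S_M_cases;
by rewrite /phi_step /= !hlength_cons IH b1 ?add0r intS.
Qed.

Lemma constrained_of_A_H bs d : code bs d -> A_H (constrained_of bs d).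
Proof.
move=> cbs; apply/A_HP; elim: bs cbs => [|[a b] bs IH].
  by move: d; rewrite /code /=; apply: S_M_cases.
rewrite code_cons => /and3P[aS bS /IH /= []].
set p := constrained_of bs d => pS pv.
have [bMW vb] : b \in S_MW /\ ~~ vertical b.
  by move: b bS; apply: S_M_cases.
split.
  rewrite all_cat /= pS bMW !andbT.
  by move: a aS; apply: S_M_cases.
by move: a aS; apply: S_M_cases;
  rewrite /phi_step /= path_nonvert2 // /nonvert2 (negbTE vb) andbF.
Qed.

(** The path is parsed from the left. A non-vertical first step is the first [b]; a vertical one is
    [a], and the step after it, never vertical, is [b], unless the path ends there and it is the
    final [d]. One or two steps are consumed each time, hence induction on a bound for the size. *)
Lemma A_H_constrained_of p : A_H p ->
  exists bs d, code bs d /\ p = constrained_of bs d.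
Proof.
move=> /A_HP[]; have [m] := ubnP (size p).
elim: m p => // m IH [|e p] /=.
  (* The empty path comes from a single level step, which is deleted. *)
  by exists [::], (1, 0).
rewrite ltnS => pm /andP[eS pS] pv.
have [ve|ve] := boolP (vertical e); last first.
  have [//|//||bs [d [cbs ->]]] := IH p; first by rewrite -(path_nonvert2 _ ve).
  exists (((1, 0), e) :: bs), d; split => //.
  rewrite code_cons cbs andbT /=.
  by move: eS ve; rewrite mem_cat /vertical => /orP[->//|->].
have [a [aS ae]] : exists a, a \in S_M /\ phi_step a = [:: e].
  move: ve; rewrite /vertical !inE => /orP[] /eqP ->.
    by exists (1, 1).
  by exists (1, -1).
case: p pm pS pv => [|f p] /=.
  by exists [::], a; rewrite /code /= aS ae.
move=> pm /andP[fS pS] /andP[]; rewrite /nonvert2 ve /= => vf.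
rewrite path_nonvert2 // => pv.
have [|//|//|bs [d [cbs ->]]] := IH p; first exact: ltnW.
exists ((a, f) :: bs), d; rewrite /= ae code_cons cbs aS andbT /=; split=> //.
by move: fS vf; rewrite mem_cat /vertical => /orP[->//|->].
Qed.

Lemma constrained_horizontalP n p :
  (A_H p /\ hlength p = n%:Z) <->
  exists bs d, [/\ code bs d, size bs = n & p = constrained_of bs d].
Proof.
split => [[/A_H_constrained_of[bs [d [cbs ->]]]]|[bs [d [cbs <- ->]]]].
  by rewrite hlength_constrained_of // => -[<-]; exists bs, d.
by split; [exact: constrained_of_A_H | exact: hlength_constrained_of].
Qed.

(** * The maps [phi] and [psi] on encoded paths *)

Lemma phi_motzkin_of bs d : phi (motzkin_of bs d) = constrained_of bs d.
Proof. by elim: bs => [|[a b] bs IH] /=; rewrite ?phi1 // phi_cons2 IH. Qed.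

Lemma nonneg_constrained_of bs d (y : int) : code bs d ->
  nonneg_from y (constrained_of bs d) = nonneg_from y (motzkin_of bs d).
Proof.
elim: bs y => [|[a b] bs IH] y.
  move: d; rewrite /code /=; apply: S_M_cases => //=.
  (* A level step makes the Motzkin path test the same height twice; [andbb] merges the two
     tests. *)
  by rewrite addr0 !andbT andbb.
rewrite code_cons => /and3P[aS bS cbs] /=.
by move: a aS; apply: S_M_cases; rewrite /phi_step /= !IH // addr0 andbA andbb.
Qed.

(* [steps_from] at an arbitrary integer abscissa, so that it can be shifted
   along the path. *)
Definition steps_at p (z : int) : seq step :=
  [seq nth 0 p k | k <- iota 0 (size p) & (vertex p k).1 == z].

Lemma steps_fromE p i : steps_from p i = steps_at p i%:Z.
Proof. by []. Qed.

(** The first step leaves from abscissa 0, so it is listed exactly when [z] is 0; the later ones are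
    seen from an origin moved by [e.1]. *)
Lemma steps_at_cons e p (z : int) :
  steps_at (e :: p) z = nseq (z == 0) e ++ steps_at p (z - e.1).
Proof.
rewrite /steps_at /= vertex0 eq_sym (iotaDl 1 0) filter_map.
have -> : [seq k <- iota 0 (size p) | preim (addn 1)
             (fun k => (vertex (e :: p) k).1 == z) k] =
          [seq k <- iota 0 (size p) | (vertex p k).1 == z - e.1].
  by apply: eq_filter => k /=; rewrite vertexS /= addrC -subr_eq opprK.
by case: eqP => _ /=; rewrite -map_comp.
Qed.

(** No step of [S_MW] goes left. *)
Lemma steps_at_lt0 p (z : int) : all [in S_MW] p -> z < 0 -> steps_at p z = [::].
Proof.
elim: p z => // e p IH z /= /andP[eS pS] z0.
rewrite steps_at_cons lt_eqF //= IH //.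
apply: le_lt_trans z0; rewrite gerBl.
by move: eS; rewrite !inE => /or4P[||| /orP[]] /eqP ->.
Qed.

(** The block at abscissa 0 restores the first pair, and the block at [i.+1] is the block at [i] of
    the path that remains after that pair. *)
Lemma psi_constrained_of bs d : code bs d ->
  psi (constrained_of bs d) = motzkin_of bs d.
Proof.
move=> cbs; rewrite /psi hlength_constrained_of // absz_nat.
elim: bs cbs => [|[a b] bs IH].
  by move: d; rewrite /code /=; apply: S_M_cases;
    rewrite /psi_block /phi_step /= ?steps_fromE ?steps_at_cons.
rewrite code_cons => /and3P[aS bS cbs].
have [pS _] := (A_HP _).1 (constrained_of_A_H cbs).
rewrite [size _]/= [constrained_of _ _]/= [motzkin_of _ _]/=.
rewrite -/(constrained_of bs d) -/(motzkin_of bs d) -(IH cbs).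
set p := constrained_of bs d in pS *.
have b1 : b.1 = 1 by move: b bS; apply: S_M_cases.
(* After [b] the path is at abscissa 1 and never comes back to 0. *)
have E0 : steps_at (phi_step a ++ b :: p) 0 = phi_step a ++ [:: b].
  have bp : steps_at (b :: p) 0 = [:: b].
    by rewrite steps_at_cons b1 steps_at_lt0.
  by move: a aS; apply: S_M_cases;
    rewrite /phi_step /= ?(steps_at_cons (_, _)) /= ?subr0 bp.
have ES i : steps_at (phi_step a ++ b :: p) i.+1%:Z = steps_at p i%:Z.
  have bp : steps_at (b :: p) i.+1%:Z = steps_at p i%:Z.
    by rewrite steps_at_cons b1 /= {1}intS [_ - 1]addrC addKr.
  by move: a aS {E0}; apply: S_M_cases;
    rewrite /phi_step /= ?(steps_at_cons (_, _)) /= ?subr0 bp.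
rewrite -[_.+2]/(1 + (size bs).+1)%N iotaD map_cat flatten_cat.
rewrite (iotaDl 1 0) -map_comp.
have -> : [seq (psi_block (phi_step a ++ b :: p) \o addn 1) i
            | i <- iota 0 (size bs).+1] =
          [seq psi_block p i | i <- iota 0 (size bs).+1].
  by apply: eq_map => i /=; rewrite /psi_block !steps_fromE ES.
rewrite /= cats0 /psi_block steps_fromE E0.
(* As [b] is not vertical, only [a] decides whether [psi_block] converts a vertical step or inserts
   a level one. *)
have [vb pb] : vertical b = false /\ psi_step b = b.
  by move: b bS {b1 E0 ES}; apply: S_M_cases.
by move: a aS {E0 ES}; apply: S_M_cases; rewrite /phi_step /= ?vb ?pb.
Qed.

Theorem theorem7 (n : nat) :
  bijection_with_inverse
    (motzkin (2 * n + 1)) [set p | A_Q p /\ hlength p = n%:Z] phi psi /\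
  bijection_with_inverse
    (grand_motzkin (2 * n + 1)) [set p | A_H p /\ hlength p = n%:Z] phi psi.
Proof.
have phiK p : grand_motzkin (2 * n + 1) p -> psi (phi p) = p.
  move=> /grand_motzkinP[bs [d [cbs _ ->]]].
  by rewrite phi_motzkin_of psi_constrained_of.
have psiK p : A_H p /\ hlength p = n%:Z -> phi (psi p) = p.
  move=> /constrained_horizontalP[bs [d [cbs _ ->]]].
  by rewrite psi_constrained_of // phi_motzkin_of.
have phiH p : grand_motzkin (2 * n + 1) p -> A_H (phi p) /\ hlength (phi p) = n%:Z.
  move=> /grand_motzkinP[bs [d [cbs sbs ->]]].
  by apply/constrained_horizontalP; exists bs, d; rewrite phi_motzkin_of.
have psiH p : A_H p /\ hlength p = n%:Z -> grand_motzkin (2 * n + 1) (psi p).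
  move=> /constrained_horizontalP[bs [d [cbs sbs ->]]].
  by apply/grand_motzkinP; exists bs, d; rewrite psi_constrained_of.
have phi_nonneg p : grand_motzkin (2 * n + 1) p ->
    nonneg_path (phi p) <-> nonneg_path p.
  move=> /grand_motzkinP[bs [d [cbs _ ->]]].
  by rewrite !nonneg_pathE phi_motzkin_of nonneg_constrained_of.
split; apply: bijection_with_inverse_cancel => //.
- by move=> p [pM p0]; have [pH pn] := phiH p pM; split=> //; split=> //;
    apply/phi_nonneg.
- move=> p [[pH p0] pn] /=; have pM := psiH p (conj pH pn).
  (* The equivalence is used at [psi p], whose image under [phi] is the nonnegative path [p]. *)
  by split=> //; apply/(phi_nonneg _ pM); rewrite psiK.
- by move=> p [pM _]; exact: phiK.
- by move=> p [[pH _] pn]; exact: psiK.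
Qed.
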